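(* Let $G=(A\cup B,E)$ be a bipartite graph with parts $A$ and $B$ having maximum degrees $\Delta_A$ and $\Delta_B$, respectively, with $\Delta_A\le\Delta_B$. Then $\chi^\star_\ell(G) \le \Delta_A+1$.
   Context: Graphs are finite and simple. That the parts $A$ and $B$ have maximum degrees $\Delta_A$ and $\Delta_B$ means $\Delta_A=\max_{a\in A}\deg(a)$ and $\Delta_B=\max_{b\in B}\deg(b)$. A list-assignment $L$ of $G$ maps each vertex $v\in V(G)$ to a set $L(v)\subseteq\mathbb{N}$ of colours; it is a $k$-list-assignment if $|L(v)|=k$ for every $v$. A proper $L$-colouring is a map $c:V(G)\to\mathbb{N}$ with $c(v)\in L(v)$ for all $v$ and $c(u)\neq c(v)$ for every edge $uv$. A proper $L$-packing of $G$ of size $k$ is a collection of $k$ proper $L$-colourings $c_1,\dots,c_k$ that are mutually disjoint, i.e. $c_i(v)\neq c_j(v)$ for all $i\neq j$ and all $v\in V(G)$. The list packing number $\chi^\star_\ell(G)$ is the least $k$ such that $G$ admits a proper $L$-packing of size $k$ for every $k$-list-assignment $L$ of $G$. *)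

(* Defs.v *)
From mathcomp Require Import all_boot.
From mathcomp Require Import finmap.

Set Implicit Arguments.
Unset Strict Implicit.
Unset Printing Implicit Defensive.

Record sgraph := SGraph {
  vertex :> finType;
  adj : rel vertex;
  adj_sym : symmetric adj;
  adj_irrefl : irreflexive adj }.

Definition degree (G : sgraph) (v : G) : nat := #|[set u | adj v u]|.

(* The maximum over an empty part is 0. *)
Definition max_degree_on (G : sgraph) (S : {set G}) : nat :=
  \max_(v in S) degree v.

Definition bipartition (G : sgraph) (A B : {set G}) : Prop :=
  [/\ A :|: B = [set: G],
      [disjoint A & B]
    & forall u v : G, adj u v ->
        (u \in A) && (v \in B) || (u \in B) && (v \in A)].

Definition list_assignment (G : sgraph) := G -> {fset nat}.

Definition k_list_assignment (G : sgraph) (k : nat) (L : list_assignment G) :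
    Prop :=
  forall v : G, #|` L v|%fset = k.

Definition proper_colouring (G : sgraph) (L : list_assignment G)
    (c : G -> nat) : Prop :=
  (forall v : G, c v \in L v) /\ (forall u v : G, adj u v -> c u <> c v).

Definition proper_packing (G : sgraph) (L : list_assignment G) (k : nat)
    (c : 'I_k -> G -> nat) : Prop :=
  (forall i : 'I_k, proper_colouring L (c i)) /\
  (forall (i j : 'I_k) (v : G), i <> j -> c i v <> c j v).

Definition packable (G : sgraph) (k : nat) : Prop :=
  forall L : list_assignment G, k_list_assignment k L ->
    exists c : 'I_k -> G -> nat, proper_packing L c.

(* [k] is the list packing number of [G]. The minimum ranges over positive
   integers: the empty family is a packing of size 0, so [packable G 0] always
   holds. This is a predicate rather than a function, so that existence of
   the minimum is not presupposed. *)
Definition is_list_packing_number (G : sgraph) (k : nat) : Prop :=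
  [/\ 0 < k, packable G k & forall j, 0 < j -> packable G j -> k <= j].

Lemma list_packing_number_uniq (G : sgraph) (k l : nat) :
  is_list_packing_number G k -> is_list_packing_number G l -> k = l.
Proof.
move=> [k0 pk mk] [l0 pl ml]; apply/eqP.
by rewrite eqn_leq mk // ml.
Qed.

(* Main.v *)
Require Import Defs.
From mathcomp Require Import all_boot.
From mathcomp Require Import finmap.
From mathcomp Require Import zify.
From Stdlib Require Import Classical.

(** Put [k = DeltaA + 1] and let all lists have size [k]. Each vertex [b] of
    [B] receives, in the [i]-th colouring, the [i]-th smallest colour of its
    list. It remains to arrange the list of each [a] in [A], independently of
    the other vertices of [A], so that its [i]-th colour differs from the
    [i]-th colour of every neighbour. That is a perfect matching problem
    between the [k] indices and the [k] colours of [L a], where a neighbour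
    [b] forbids the pair of an index [i] and a colour [x] when [x] has rank
    [i] in [L b].

    The point of using ranks is that the pairs forbidden by one neighbour form
    a strictly increasing partial map from indices to colours. If the condition
    of [hall_marriage] failed, there would be sets [S] of indices and [T] of colours
    with [#|S| + #|T| > k] and all pairs of [S] times [T] forbidden. The first
    row and the first column of this rectangle form a hook of
    [#|S| + #|T| - 1 >= k] cells, no two of which can lie on one strictly
    increasing map ([hook_bound]); so [a] would have at least [k] neighbours,
    whereas it has at most [k - 1].

    For arbitrary packings on [B] this fails: [k - 1] unordered partial
    matchings can cover such a rectangle as soon as both sides are at least
    two. *)

Set Implicit Arguments.
Unset Strict Implicit.
Unset Printing Implicit Defensive.

(** * Hall's marriage theorem *)

Section Hall.
Variables I T : finType.
Implicit Type F : I -> {set T}.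

Definition hall_condition F :=
  [forall S : {set I}, #|S| <= #|\bigcup_(i in S) F i|].

Definition remove_at F x y := fun z => if z == x then F x :\ y else F z.

Lemma hall_conditionP F :
  reflect (forall S : {set I}, #|S| <= #|\bigcup_(i in S) F i|)
          (hall_condition F).
Proof. exact: forallP. Qed.

(** Rado's step: sets [S1] and [S2] witnessing that neither [y1] nor [y2] can
    be dropped from [F x] would, by submodularity of the size of the union,
    violate Hall's condition for [F] on [S1 :|: S2] or [S1 :&: S2 :\ x]. *)
Lemma hall_remove F x y1 y2 : y1 != y2 -> hall_condition F ->
  hall_condition (remove_at F x y1) || hall_condition (remove_at F x y2).
Proof.
move=> y12 /hall_conditionP HF; apply/norP => -[].
rewrite !negb_forall => /existsP[S1]; rewrite -ltnNge => lt1.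
move=> /existsP[S2]; rewrite -ltnNge => lt2.
have witness_mem (S : {set I}) y :
    #|\bigcup_(i in S) remove_at F x y i| < #|S| -> x \in S.
  apply: contraLR => xS; rewrite -leqNgt; apply: leq_trans (HF S) _.
  apply/subset_leq_card/bigcupsP => i iS.
  apply: subset_trans (bigcup_sup i iS); rewrite /remove_at.
  by case: eqP => // ix; rewrite -ix iS in xS.
have x1 := witness_mem _ _ lt1; have x2 := witness_mem _ _ lt2.
move: lt1 lt2.
set U1 := \bigcup_(i in S1) _; set U2 := \bigcup_(i in S2) _ => lt1 lt2.
have subU : \bigcup_(i in S1 :|: S2) F i \subset U1 :|: U2.
  apply/subsetP => y /bigcupP[i iS yF]; rewrite inE.
  have [eix|nix] := eqVneq i x.
    rewrite eix in yF; have [eyy|nyy] := eqVneq y y1.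
      apply/orP; right; apply/bigcupP; exists x => //.
      by rewrite /remove_at eqxx !inE yF eyy y12.
    apply/orP; left; apply/bigcupP; exists x => //.
    by rewrite /remove_at eqxx !inE yF nyy.
  move: iS; rewrite inE => /orP[] iS; apply/orP; [left|right];
    by apply/bigcupP; exists i; rewrite // /remove_at (negPf nix).
have subI : \bigcup_(i in (S1 :&: S2) :\ x) F i \subset U1 :&: U2.
  apply/subsetP => y /bigcupP[i]; rewrite !inE => /and3P[nix i1 i2] yF.
  by apply/andP; split; apply/bigcupP; exists i;
    rewrite // /remove_at (negPf nix).
have leU := leq_trans (HF _) (subset_leq_card subU).
have leI := leq_trans (HF _) (subset_leq_card subI).
have := cardsUI S1 S2; have := cardsUI U1 U2.
have := cardsD1 x (S1 :&: S2); rewrite inE x1 x2 /= add1n.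
lia.
Qed.

Lemma remove_at_sum F x y : y \in F x ->
  \sum_i #|remove_at F x y i| < \sum_i #|F i|.
Proof.
move=> yF; rewrite (bigD1 x) //= [X in _ < X](bigD1 x) //= /remove_at eqxx.
rewrite (cardsD1 y (F x)) yF add1n addSn ltnS leq_add2l.
by apply: leq_sum => i /negPf->.
Qed.

(** Elements are dropped by [hall_remove] until each set has at most one
    element; Hall's condition for sets of one and of two indices then makes the
    sets nonempty and pairwise distinct. *)
Theorem hall_marriage F : hall_condition F ->
  exists2 f : I -> T, injective f & forall i, f i \in F i.
Proof.
have [n] := ubnP (\sum_i #|F i|); elim: n F => // n IHn F ltn HF.
have [x Fx_gt1 | F_le1] := pickP [pred x | 1 < #|F x|].
  have /card_gt1P[y1 [y2 [y1F y2F y12]]] := Fx_gt1.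
  have step y : y \in F x -> hall_condition (remove_at F x y) ->
      exists2 f : I -> T, injective f & forall i, f i \in F i.
    move=> yF /IHn[|f f_inj fF].
      exact: leq_trans (remove_at_sum yF) _.
    exists f => // i; move: (fF i); rewrite /remove_at.
    by case: eqP => // ->; rewrite inE => /andP[].
  by have /orP[/(step _ y1F)|/(step _ y2F)] := hall_remove x y12 HF.
have singleton i : exists y, F i = [set y].
  apply/cards1P; have /= le1 := F_le1 i; rewrite eqn_leq leqNgt le1 /=.
  by have /hall_conditionP/(_ [set i]) := HF; rewrite cards1 big_set1.
have [f Ff] := fin_all_exists singleton.
exists f => [i j fij|i]; last by rewrite Ff set11.
apply/eqP/contraT => nij; have /hall_conditionP/(_ [set i; j]) := HF.
by rewrite big_setU1 ?inE //= big_set1 !Ff fij setUid cards1 cards2 nij.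
Qed.

End Hall.

(** * Covering rectangles by increasing relations *)

(** The relations [r d] cover the rectangle [S] times [T], and each of them is
    strictly increasing. Let [s0] and [t0] be the least elements of [S] and
    [T]. No two of the cells [(s, t0)] and [(s0, t)] increase strictly in both
    coordinates, so no [r d] contains two of them. *)
Lemma hook_bound (V : finType) n m (S : {set 'I_n}) (T : {set 'I_m})
    (D : {set V}) (r : V -> 'I_n -> 'I_m -> bool) :
  (forall d i i' j j', r d i j -> r d i' j' -> (i < i') = (j < j')) ->
  S != set0 -> T != set0 ->
  (forall i j, i \in S -> j \in T -> exists2 d, d \in D & r d i j) ->
  #|S| + #|T| <= #|D|.+1.
Proof.
move=> r_incr /set0Pn[s1 s1S] /set0Pn[t1 t1T] cover.
case: (arg_minnP (fun i : 'I_n => val i) s1S) => s0 s0S s0_min.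
case: (arg_minnP (fun j : 'I_m => val j) t1T) => t0 t0T t0_min.
pose column := [set (s, t0) | s in S]; pose row := [set (s0, t) | t in T].
have hook_card : #|S| + #|T| <= #|column :|: row|.+1.
  have <- : #|column| = #|S| by apply: card_imset => ? ? [].
  have <- : #|row| = #|T| by apply: card_imset => ? ? [].
  rewrite -cardsUI -addn1 leq_add2l -(cards1 (s0, t0)).
  apply/subset_leq_card/subsetP => p; rewrite inE.
  by move=> /andP[/imsetP[s _ ->] /imsetP[t _ [-> _]]]; rewrite set11.
have hook_rect p : p \in column :|: row ->
    [/\ p.1 \in S, p.2 \in T & (p.1 == s0) || (p.2 == t0)].
  by rewrite inE => /orP[] /imsetP[z zin ->] /=; rewrite eqxx ?orbT.
apply: (leq_trans hook_card); rewrite ltnS.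
have [d0 _ _] := cover _ _ s0S t0T.
(* [g p] is a relation that covers [p]; the default is never used on the
   hook. *)
pose g p := odflt d0 [pick d in D | r d p.1 p.2].
have gP p : p \in column :|: row -> g p \in D /\ r (g p) p.1 p.2.
  case/hook_rect => pS pT _; rewrite /g; case: pickP => [d /andP[]|none] //.
  by have [d dD rd] := cover _ _ pS pT; have /andP[] := none d.
rewrite -(card_in_imset (f := g)).
  by apply/subset_leq_card/subsetP => _ /imsetP[p /gP[gD _] ->].
move=> [i j] [i' j'] pH qH gpq.
have [/= iS jT ij0] := hook_rect _ pH; have [/= iS' jT' ij0'] := hook_rect _ qH.
have [_ /= rp] := gP _ pH; have [_ /= rq] := gP _ qH.
rewrite gpq in rp.
have lt1 := r_incr _ _ _ _ _ rp rq; have lt2 := r_incr _ _ _ _ _ rq rp.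
have /= le1 := s0_min _ iS; have /= le2 := s0_min _ iS'.
have /= le3 := t0_min _ jT; have /= le4 := t0_min _ jT'.
have [eqi eqj] : i = i' :> nat /\ j = j' :> nat.
  by move: ij0 ij0' lt1 lt2; rewrite -!val_eqE /=; lia.
by congr pair; apply: val_inj.
Qed.

(** * Ranks in a finite set of numbers *)

Definition ranked (X : {fset nat}) (i : nat) : nat := nth 0 (sort leq X) i.

Lemma ranked_in (X : {fset nat}) i : i < #|` X|%fset -> ranked X i \in X.
Proof. by move=> ltiX; rewrite -(mem_sort leq) mem_nth ?size_sort. Qed.

Lemma ranked_ltn (X : {fset nat}) i j :
  i < #|` X|%fset -> j < #|` X|%fset -> (ranked X i < ranked X j) = (i < j).
Proof.
move=> ltiX ltjX.
have X_sorted : sorted ltn (sort leq X).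
  rewrite ltn_sorted_uniq_leq sort_uniq fset_uniq; apply: sort_sorted.
  exact: leq_total.
have ltn_homo := sorted_ltn_nth ltn_trans 0 X_sorted.
case: (ltngtP i j) => [ltij|ltji|->]; last by rewrite ltnn.
- by apply: ltn_homo; rewrite ?inE ?size_sort.
- by apply/negbTE; rewrite -leqNgt ltnW //; apply: ltn_homo;
    rewrite ?inE ?size_sort.
Qed.

Lemma ranked_inj (X : {fset nat}) i j :
  i < #|` X|%fset -> j < #|` X|%fset -> ranked X i = ranked X j -> i = j.
Proof.
move=> ltiX ltjX eqX; have := ranked_ltn ltiX ltjX.
by have := ranked_ltn ltjX ltiX; rewrite eqX ltnn; lia.
Qed.

(** * Packings of bipartite graphs *)

(** This is what a single vertex of [A] needs, with [M] its list and [D] its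
    neighbourhood. A violation [S] of Hall's condition gives a rectangle of
    forbidden pairs, [S] times the complement of the neighbours of [S], whose
    sides add up to more than [k]; [hook_bound] then contradicts
    [#|D| < k]. *)
Lemma rank_avoiding_matching (V : finType) (D : {set V}) (L : V -> {fset nat})
    (M : {fset nat}) k :
  #|D| < k -> #|` M|%fset = k -> (forall v, #|` L v|%fset = k) ->
  exists2 f : 'I_k -> 'I_k, injective f &
    forall i b, b \in D -> ranked M (f i) != ranked (L b) i.
Proof.
move=> ltDk Mk Lk.
pose F (i : 'I_k) :=
  [set j : 'I_k | [forall b in D, ranked M j != ranked (L b) i]].
suff /hall_marriage[f f_inj fF] : hall_condition F.
  by exists f => // i b bD; have:= fF i; rewrite inE => /forall_inP/(_ b bD).
apply/hall_conditionP => S; rewrite leqNgt; apply/negP => ltS.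
set N := \bigcup_(i in S) _ in ltS.
have cardN := cardsC N; rewrite card_ord in cardN.
have S_neq0 : S != set0 by rewrite -card_gt0; lia.
have N_neq0 : ~: N != set0.
  by rewrite -card_gt0; have := max_card S; rewrite card_ord; lia.
suff : #|S| + #|~: N| <= #|D|.+1 by lia.
apply: (hook_bound (r := fun b i j => ranked M j == ranked (L b) i)) => //.
  move=> b i i' j j' /eqP eqj /eqP eqj'.
  by rewrite -(@ranked_ltn (L b)) ?Lk // -eqj -eqj' ranked_ltn ?Mk.
move=> i j iS; rewrite inE => jN.
have : j \notin F i by apply: contra jN => jF; apply/bigcupP; exists i.
by rewrite inE negb_forall_in => /exists_inP[b bD /negPn rb]; exists b.
Qed.

Lemma bipartite_packable (G : sgraph) (A B : {set G}) :
  bipartition A B -> packable G (max_degree_on A).+1.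
Proof.
move=> [AUB dAB edges] L Lk; set k := (max_degree_on A).+1 in Lk *.
have matching a : exists f : 'I_k -> 'I_k, a \in A ->
    injective f /\
    forall i b, adj a b -> ranked (L a) (f i) != ranked (L b) i.
  case aA: (a \in A); last by exists id.
  have deg_lt : #|[set b | adj a b]| < k.
    by rewrite ltnS; apply: (leq_bigmax_cond (F := @degree G)).
  have [f f_inj fL] := rank_avoiding_matching deg_lt (Lk a) Lk.
  by exists f => _; split => // i b ab; apply: fL; rewrite inE.
have [f fP] := fin_all_exists matching.
pose rank_of (i : 'I_k) v := if v \in A then f v i else i.
exists (fun i v => ranked (L v) (rank_of i v)); split=> [i|i j v nij].
  split=> [v|u v uv]; first by apply: ranked_in; rewrite Lk.
  wlog uA : u v uv / u \in A.
    move=> wlogA; have /orP[/andP[uA _]|/andP[_ vA]] := edges _ _ uv.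
      exact: wlogA.
    by apply/nesym/wlogA; rewrite // adj_sym.
  have vA : v \in A = false.
    have uB := disjointFr dAB uA.
    by have := edges _ _ uv; rewrite uA uB orbF => /(disjointFl dAB).
  by rewrite /rank_of uA vA; apply/eqP; have [_ ->] := fP u uA.
move=> /ranked_inj; rewrite Lk => /(_ (ltn_ord _) (ltn_ord _)) /val_inj.
rewrite /rank_of; case: ifP => [vA|_ //].
by have [f_inj _] := fP v vA; move/f_inj.
Qed.

Lemma list_packing_number_le (G : sgraph) n :
  0 < n -> packable G n -> exists k, is_list_packing_number G k /\ k <= n.
Proof.
have [m] := ubnP n; elim: m n => // m IHm n ltnm n_gt0 nP.
case: (classic (exists2 j, 0 < j < n & packable G j)) => [[j jn jP]|none].
  have [||k [kP lekj]] := IHm j _ _ jP; [lia..|].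
  by exists k; split => //; lia.
exists n; split => //; split => // j j_gt0 jP.
rewrite leqNgt; apply/negP => ltjn.
by apply: none; exists j => //; rewrite j_gt0.
Qed.

Theorem lemma33 (G : sgraph) (A B : {set G}) (DeltaA DeltaB : nat)
    (hAB : bipartition A B)
    (hA : DeltaA = max_degree_on A)
    (hB : DeltaB = max_degree_on B)
    (hle : DeltaA <= DeltaB) :
  exists k : nat, is_list_packing_number G k /\ k <= DeltaA + 1.
Proof.
rewrite hA addn1; apply: list_packing_number_le => //.
exact: bipartite_packable hAB.
Qed.
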